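(* For all integers $m>n\ge 1$, we have $d_{\mathrm{GH}}(B^m,B^n)\ge \frac18$.
   Context: $B^n=\{x\in\mathbb{R}^n : x_1^2+\cdots+x_n^2\le 1\}$ is the closed unit ball, regarded as a metric space with the Euclidean metric. The Gromov--Hausdorff distance $d_{\mathrm{GH}}(X,Y)$ between metric spaces $X,Y$ is the infimum, over all metric spaces $Z$ and isometric embeddings $\phi\colon X\to Z$, $\psi\colon Y\to Z$, of the Hausdorff distance in $Z$ between $\phi(X)$ and $\psi(Y)$. Equivalently, $d_{\mathrm{GH}}(X,Y)=\frac12\inf_C \sup_{(x,y),(x',y')\in C}|d_X(x,x')-d_Y(y,y')|$, where $C$ ranges over all correspondences, i.e. relations $C\subseteq X\times Y$ whose projections to $X$ and to $Y$ are both surjective. *)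

(* Defs.v *)
From HB Require Import structures.
From mathcomp Require Import all_boot all_order all_algebra.
From mathcomp Require Import all_classical all_reals all_analysis.
From mathcomp Require Import ring.

Set Implicit Arguments.
Unset Strict Implicit.
Unset Printing Implicit Defensive.

Import Order.TTheory GRing.Theory Num.Theory.

Local Open Scope classical_set_scope.
Local Open Scope ring_scope.

Section GromovHausdorff.
Context {R : realType}.

Definition isometric_embedding (X Z : metricType R) (f : X -> Z) : Prop :=
  forall x x' : X, mdist (f x) (f x') = mdist x x'.

Definition thickening (Z : metricType R) (A : set Z) (e : R) : set Z :=
  \bigcup_(a in A) ball a e.

(* The library's [ball a e] is the open ball, so [thickening A e] is the open
   e-neighbourhood of A; the value is +oo when one of the two sets lies in no
   thickening of the other. *)
Definition hausdorff_distance (Z : metricType R) (A B : set Z) : \bar R :=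
  ereal_inf [set e%:E | e in [set e : R |
    [/\ 0 < e, A `<=` thickening B e & B `<=` thickening A e]]].

Definition dGH (X Y : metricType R) : \bar R :=
  ereal_inf [set h : \bar R |
    exists (Z : metricType R) (phi : X -> Z) (psi : Y -> Z),
      [/\ isometric_embedding phi, isometric_embedding psi
        & h = hausdorff_distance (range phi) (range psi)]].

End GromovHausdorff.

Section Euclidean.
Context {R : realType} {n : nat}.
Implicit Types x y z : 'rV[R]_n.

(* The library norm on 'rV[R]_n is the sup norm, so the Euclidean one is
   introduced separately. *)
Definition euclidean_norm x : R := Num.sqrt (\sum_(i < n) x 0 i ^+ 2).

Definition euclidean_dist x y : R := euclidean_norm (x - y).

Lemma sum_sqr_ge0 x : 0 <= \sum_(i < n) x 0 i ^+ 2.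
Proof. by apply: sumr_ge0 => i _; exact: sqr_ge0. Qed.

Lemma euclidean_norm_ge0 x : 0 <= euclidean_norm x.
Proof. exact: sqrtr_ge0. Qed.

Lemma sqr_euclidean_norm x : euclidean_norm x ^+ 2 = \sum_(i < n) x 0 i ^+ 2.
Proof. by rewrite sqr_sqrtr// sum_sqr_ge0. Qed.

Lemma euclidean_norm0_eq0 x : euclidean_norm x = 0 -> x = 0.
Proof.
move=> x0; have /eqP : \sum_(i < n) x 0 i ^+ 2 = 0.
  by rewrite -sqr_euclidean_norm x0 expr0n.
rewrite psumr_eq0; last by move=> i _; exact: sqr_ge0.
move=> /allP h; apply/rowP => i; rewrite mxE.
by have := h i (mem_index_enum i); rewrite sqrf_eq0 => /eqP.
Qed.

Lemma cauchy_schwarz_sum x y :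
  \sum_(i < n) x 0 i * y 0 i <= euclidean_norm x * euclidean_norm y.
Proof.
set a := euclidean_norm x; set b := euclidean_norm y.
have [/euclidean_norm0_eq0 x0|a0] := eqVneq a 0.
  rewrite big1 ?mulr_ge0 ?euclidean_norm_ge0// => i _.
  by rewrite x0 mxE mul0r.
have [/euclidean_norm0_eq0 y0|b0] := eqVneq b 0.
  rewrite big1 ?mulr_ge0 ?euclidean_norm_ge0// => i _.
  by rewrite y0 mxE mulr0.
have ab : 0 < a * b by rewrite mulr_gt0// lt0r ?a0 ?b0 euclidean_norm_ge0.
have : 0 <= \sum_(i < n) (b * x 0 i - a * y 0 i) ^+ 2.
  by apply: sumr_ge0 => i _; exact: sqr_ge0.
have -> : \sum_(i < n) (b * x 0 i - a * y 0 i) ^+ 2 =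
    b ^+ 2 * \sum_(i < n) x 0 i ^+ 2 + a ^+ 2 * \sum_(i < n) y 0 i ^+ 2
    - (a * b * \sum_(i < n) x 0 i * y 0 i) *+ 2.
  rewrite !mulr_sumr -sumrMnl -sumrN -!big_split/=.
  by apply: eq_bigr => i _; ring.
rewrite -!sqr_euclidean_norm -/a -/b (mulrC (b ^+ 2)) -mulr2n -mulrnBl pmulrn_lge0//.
by rewrite -exprMn expr2 -mulrBr pmulr_rge0// subr_ge0.
Qed.

Lemma euclidean_normD x y :
  euclidean_norm (x + y) <= euclidean_norm x + euclidean_norm y.
Proof.
rewrite -ler_sqr ?nnegrE ?addr_ge0 ?euclidean_norm_ge0//.
rewrite sqrrD !sqr_euclidean_norm.
have -> : \sum_(i < n) (x + y) 0 i ^+ 2 =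
    \sum_(i < n) x 0 i ^+ 2 + (\sum_(i < n) x 0 i * y 0 i) *+ 2
    + \sum_(i < n) y 0 i ^+ 2.
  by rewrite -sumrMnl -!big_split/=; apply: eq_bigr => i _; rewrite mxE sqrrD.
by rewrite lerD2r lerD2l lerMn2r cauchy_schwarz_sum.
Qed.

Lemma euclidean_distxx x : euclidean_dist x x = 0.
Proof.
rewrite /euclidean_dist subrr /euclidean_norm big1 ?sqrtr0// => i _.
by rewrite mxE expr0n.
Qed.

Lemma euclidean_dist_sym x y : euclidean_dist x y = euclidean_dist y x.
Proof.
rewrite /euclidean_dist /euclidean_norm; congr Num.sqrt.
by apply: eq_bigr => i _; rewrite -opprB mxE sqrrN.
Qed.

Lemma euclidean_dist_triangle y x z :
  euclidean_dist x z <= euclidean_dist x y + euclidean_dist y z.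
Proof.
rewrite /euclidean_dist.
have -> : x - z = (x - y) + (y - z) by rewrite addrA subrK.
exact: euclidean_normD.
Qed.

End Euclidean.

Definition unit_ball (R : realType) (n : nat) : Type :=
  {x : 'rV[R]_n | \sum_(i < n) x 0 i ^+ 2 <= 1}.

Section UnitBallMetric.
Variables (R : realType) (n : nat).
Local Notation B := (unit_ball R n).

HB.instance Definition _ := Choice.copy B
  {x : 'rV[R]_n | \sum_(i < n) x 0 i ^+ 2 <= 1}.

Let dist (x y : B) : R := euclidean_dist (sval x) (sval y).

Let dist_eq0 x y : dist x y = 0 -> x = y.
Proof.
by move=> /euclidean_norm0_eq0/eqP; rewrite subr_eq0 => /eqP/val_inj.
Qed.

HB.instance Definition _ := @isMetric.Build R B dist
  (fun x => euclidean_distxx (sval x)) dist_eq0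
  (fun x y => euclidean_dist_sym (sval x) (sval y))
  (fun y x z => euclidean_dist_triangle (sval y) (sval x) (sval z)).

End UnitBallMetric.

Lemma mdist_unit_ballE (R : realType) (n : nat) (x y : unit_ball R n) :
  mdist x y = Num.sqrt (\sum_(i < n) (sval x 0 i - sval y 0 i) ^+ 2).
Proof.
rewrite /mdist/= /euclidean_dist /euclidean_norm; congr Num.sqrt.
by apply: eq_bigr => i _; rewrite !mxE.
Qed.

(* Main.v *)
Require Import Defs.
From mathcomp Require Import all_boot all_order all_algebra all_fingroup.
From mathcomp Require Import all_classical all_reals all_analysis.
From mathcomp Require Import zify ring lra.

(** Suppose that both balls embed isometrically in one metric space, each
    within the e-neighbourhood of the other, with e < 1/8.  Choosing nearby
    points gives maps f from B^m to B^n and g from B^n to B^m.  They need not be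
    continuous, but f increases distances by at most 2e, and
    |g w - x| <= |w - f x| + 2e for all w and x.  Averaging f and g over small
    balls, with Lipschitz weights ([lipschitz_smoothing]), yields Lipschitz maps
    F and G.  An average of values lies no farther from a given point than the
    values do, so the two inequalities survive up to a small error: F x stays
    within about 2e of f x, and therefore G (F x) within about 4e of x.  Since
    4e < 1/2, the map G o F moves every point by at most 5/8.

    Two facts then contradict each other.  On the one hand, a Lipschitz map of
    B^m to itself that moves no point by more than c < 1 comes arbitrarily close
    to every point of norm less than 1 - c ([near_identity_dense]).  On the other
    hand, G o F factors through B^n, so its image is covered by O(Q^n) sets of
    diameter O(1/Q), and these are too few to come close to all the Q^m points
    of a grid of mesh proportional to 1/Q when n < m and Q is large
    ([lipschitz_image_not_dense]).

    The first fact is of the strength of the theorem of Brouwer.  It is deduced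
    from an approximate form of the theorem of Poincare and Miranda: if the i-th
    coordinate of a Lipschitz map is negative on one face of a cube orthogonal
    to the i-th axis and nonnegative on the opposite face, for every i, then the
    map has values of arbitrarily small norm.  Cutting the cube into small ones
    reduces this to a combinatorial statement about sign patterns on a grid
    ([discrete_poincare_miranda]), which is proved by computing a degree.  Each
    sign pattern is a 0-cochain h_i on the triangulation of the grid into Kuhn
    simplices; the degree is the sum, over the signed simplices, of the cup
    product of the coboundaries of the h_i.  Changing one h_i away from its two
    faces adds to the cup product the coboundary of a cochain that vanishes on
    the boundary of the grid, so the degree depends only on the values on the
    faces, and it equals 1 for one explicit choice.  As the degree is not 0, on
    some simplex all the h_i are non-constant. *)

Set Implicit Arguments.
Unset Strict Implicit.
Unset Printing Implicit Defensive.

Import Order.TTheory GRing.Theory Num.Theory.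

Local Open Scope ring_scope.

(** * Signed sums over Kuhn simplices *)

Section Kuhn.
Variable n : nat.
Local Notation vtx := ('I_n.+1 -> nat).

(** The k-th vertex of the Kuhn simplex that starts at [q] and then moves by one
    unit along the axes s 0, s 1, ... in this order: after k moves, the axes
    already used are those that the inverse of [s] sends below k. *)
Definition kuhn_vertex (q : vtx) (s : 'S_n.+1) (k : nat) : vtx :=
  fun a => (q a + ((s^-1)%g a < k))%N.

(** The grid {0, ..., N}^(n+1) is cut into unit cubes, one for each [p], and each
    cube into Kuhn simplices, one for each permutation [s], oriented by the sign
    of [s]. *)
Definition kuhn_sum N (c : (nat -> vtx) -> int) : int :=
  \sum_(p : {ffun 'I_n.+1 -> 'I_N}) \sum_(s : 'S_n.+1)
    (-1) ^+ s * c (kuhn_vertex (fun a => p a) s).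

(** Exchanging two consecutive moves changes only the vertex between them, so the
    two Kuhn simplices share the opposite face and have opposite signs. *)
Lemma kuhn_sum_inner_face N (c : (nat -> vtx) -> int) (l : nat) :
  (0 < l < n.+1)%N -> kuhn_sum N (fun v => c (v \o bump l)) = 0.
Proof.
case: l => // j /andP[_ jn]; rewrite /kuhn_sum big1// => p _.
set S := (X in X = 0).
pose t : 'S_n.+1 := tperm (inord j) (inord j.+1).
suff : S = - S by lia.
rewrite {1}/S (reindex_inj (mulgI t))/= /S -sumrN; apply: eq_bigr => s _.
have -> : (-1) ^+ (t * s)%g = - (-1) ^+ s :> int.
  rewrite odd_permM odd_tperm signr_addb.
  have -> : inord j != inord j.+1 :> 'I_n.+1.
    by apply/eqP => /(congr1 val); rewrite /= !inordK; lia.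
  by rewrite expr1 mulN1r.
rewrite mulNr; congr (- (_ * c _)); apply: funext => k /=; apply: funext => a.
rewrite /kuhn_vertex; congr (_ + nat_of_bool _)%N.
rewrite invMg permM tpermV; set b := (s^-1)%g a.
rewrite /t /bump; case: tpermP => [->|->|]; rewrite ?inordK; lia.
Qed.

(** Dropping the first vertex of a simplex gives the same face as dropping the
    last vertex of the simplex one step further along the first axis, whose moves
    are rotated cyclically.  Only the faces in the boundary of the grid remain
    unmatched, and [c] vanishes there. *)
Lemma kuhn_sum_outer_faces N (c : (nat -> vtx) -> int) :
  (forall w w', (forall k, (k <= n)%N -> w k = w' k) -> c w = c w') ->
  (forall w a, (forall k, (k <= n)%N -> w k a = 0%N) -> c w = 0) ->
  (forall w a, (forall k, (k <= n)%N -> w k a = N) -> c w = 0) ->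
  kuhn_sum N (fun v => c (v \o bump 0)) =
  (-1) ^+ n * kuhn_sum N (fun v => c (v \o bump n.+1)).
Proof.
move=> cext c0 cN; rewrite /kuhn_sum mulr_sumr exchange_big /=.
under [RHS]eq_bigr do rewrite mulr_sumr.
rewrite [RHS]exchange_big /=.
(* The rotation i |-> i + 1, which sends the last index to 0. *)
pose rho : 'S_n.+1 := lift_perm ord_max ord0 1%g.
have rho_max : rho ord_max = ord0 by rewrite lift_perm_id.
have rho_lift (i : 'I_n) : rho (lift ord_max i) = lift ord0 i.
  by rewrite lift_perm_lift perm1.
have rhoV (b : 'I_n.+1) : (rho^-1)%g b = (if b == 0%N :> nat then n else b.-1) :> nat.
  case: (unliftP ord0 b) => [i ->|->] /=.
    by rewrite -rho_lift permK /= /bump leqNgt ltn_ord.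
  by rewrite -rho_max permK.
rewrite [RHS](reindex_inj (mulgI rho))/=; apply: eq_bigr => s _.
have -> : (-1) ^+ (rho * s)%g = (-1) ^+ n * (-1) ^+ s :> int.
  by rewrite odd_permM odd_lift_perm odd_perm1 addbF addbF signr_addb signr_odd.
rewrite -!mulr_sumr [RHS]mulrA [X in _ = X * _]mulrA -expr2 sqrr_sign mul1r.
congr (_ * _).
pose a := s ord0.
case: N cN => [|N] cN; first by rewrite !big1// => p _; case: (p ord0).
(* Translation along the axis a, made cyclic to be a bijection of the base points:
   at the wrap-around both faces lie in the boundary. *)
pose shift (p : {ffun 'I_n.+1 -> 'I_N.+1}) : {ffun 'I_n.+1 -> 'I_N.+1} :=
  [ffun b => if b == a then ordS (p b) else p b].
have shift_inj : injective shift.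
  move=> p q /ffunP pq; apply/ffunP => b; have := pq b; rewrite !ffunE.
  by case: eqP => // _ /ordS_inj.
rewrite [RHS](reindex_inj shift_inj)/=; apply: eq_bigr => p _.
have sV0 (b : 'I_n.+1) : ((s^-1)%g b == 0%N :> nat) = (b == a).
  apply/eqP/eqP => [b0|->]; last by rewrite /a permK.
  by rewrite /a; have -> : ord0 = (s^-1)%g b by [apply: val_inj]; rewrite permKV.
have [pa|pa] := eqVneq (p a : nat) N.
  rewrite (cN _ a) => [|k kn /=]; last first.
    rewrite /kuhn_vertex pa /bump /=; have /eqP -> := etrans (sV0 a) (eqxx a).
    lia.
  rewrite (c0 _ a)// => k kn /=.
  rewrite /kuhn_vertex ffunE eqxx /= pa modnn invMg permM rhoV sV0 eqxx /bump.
  lia.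
apply: cext => k kn /=; apply: funext => b.
rewrite /kuhn_vertex ffunE invMg permM rhoV sV0 /bump.
case: (eqVneq b a) => [->|ba].
  have /eqP -> := etrans (sV0 a) (eqxx a).
  rewrite /= modn_small; last by have := ltn_ord (p a); lia.
  lia.
have : (s^-1)%g b != 0%N :> nat by rewrite sV0.
by move: (nat_of_ord ((s^-1)%g b)) => t t0; lia.
Qed.
End Kuhn.

(** * The coboundary of a cup product *)

(** In this section [a j t] stands for the value of the j-th 0-cochain at the t-th
    vertex of a simplex, and [bump l] enumerates the vertices other than the l-th.
    A product of coboundaries is a cocycle: the alternating sum of its values on
    all faces is 0.  The first two lemmas leave out one outer face, the last one
    or the first one, so that the sum is the opposite of the term missing. *)
Section Leibniz.
Variable a : nat -> nat -> int.

Lemma alternating_prefix i :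
  \sum_(l < i.+1) (-1) ^+ l *
     \prod_(0 <= j < i) (a j (bump l j.+1) - a j (bump l j)) =
  (-1) ^+ i * \prod_(0 <= j < i) (a j j.+1 - a j j).
Proof.
elim: i => [|i IH]; first by rewrite big_ord_recl big_ord0 !big_nil addr0.
rewrite big_ord_recr /= big_nat_recr //= [in RHS]big_nat_recr //=.
have -> : \prod_(0 <= j < i) (a j (bump i.+1 j.+1) - a j (bump i.+1 j)) =
    \prod_(0 <= j < i) (a j j.+1 - a j j).
  apply: eq_big_nat => j ji; rewrite /bump.
  by have [-> ->] : (i < j.+1)%N = false /\ (i < j)%N = false by lia.
under eq_bigr => l _.
  rewrite big_nat_recr //= mulrA.
  have -> : bump l i.+1 = i.+2 by rewrite /bump; have := ltn_ord l; lia.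
  have -> : bump l i = i.+1 by rewrite /bump; have := ltn_ord l; lia.
  over.
rewrite -mulr_suml IH.
have -> : bump i.+1 i.+1 = i.+2 by rewrite /bump; lia.
have -> : bump i.+1 i = i by rewrite /bump; lia.
by rewrite exprS; ring.
Qed.

Lemma alternating_suffix i d :
  \sum_(i.+1 <= l < (i.+1 + d).+1) (-1) ^+ l *
     \prod_(i.+1 <= j < i.+1 + d) (a j (bump l j) - a j (bump l j.-1)) =
  (-1) ^+ i.+1 * \prod_(i.+1 <= j < i.+1 + d) (a j j.+1 - a j j).
Proof.
elim: d => [|d IH].
  by rewrite addn0 big_nat1 !big_geq.
rewrite addnS; set t := (i.+1 + d)%N in IH *.
have it : (i.+1 <= t)%N by rewrite leq_addr.
have split_last l : \prod_(i.+1 <= j < t.+1) (a j (bump l j) - a j (bump l j.-1)) =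
   \prod_(i.+1 <= j < t) (a j (bump l j) - a j (bump l j.-1)) *
   (a t (bump l t) - a t (bump l t.-1)).
  by rewrite big_nat_recr.
under [LHS]eq_bigr do rewrite split_last mulrA.
rewrite [in RHS]big_nat_recr //= mulrA -IH.
rewrite big_nat_recr /=; last by rewrite leqW.
rewrite [X in X + _ = _]big_nat_recr //= [X in _ = X * _]big_nat_recr //=.
set Q := fun l => \prod_(i.+1 <= j < t) (a j (bump l j) - a j (bump l j.-1)).
have -> : \sum_(i.+1 <= l < t) (-1) ^+ l * Q l * (a t (bump l t) - a t (bump l t.-1)) =
    (\sum_(i.+1 <= l < t) (-1) ^+ l * Q l) * (a t t.+1 - a t t).
  rewrite mulr_suml; apply: eq_big_nat => l lt.
  have -> : bump l t = t.+1 by rewrite /bump; lia.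
  by have -> : bump l t.-1 = t by rewrite /bump; lia.
rewrite -/(Q t) -/(Q t.+1).
have -> : Q t.+1 = Q t.
  apply: eq_big_nat => j jt.
  have -> : bump t.+1 j = j by rewrite /bump; lia.
  have -> : bump t.+1 j.-1 = j.-1 by rewrite /bump; lia.
  have -> : bump t j = j by rewrite /bump; lia.
  by have -> : bump t j.-1 = j.-1 by rewrite /bump; lia.
have -> : bump t t = t.+1 by rewrite /bump; lia.
have -> : bump t t.-1 = t.-1 by rewrite /bump; lia.
have -> : bump t.+1 t = t by rewrite /bump; lia.
have -> : bump t.+1 t.-1 = t.-1 by rewrite /bump; lia.
by rewrite exprS; ring.
Qed.

(** The Leibniz rule: the coboundaries of the j-th cochains, j <> i, are cocycles,
    so the coboundary of their cup product with the i-th cochain itself, put in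
    position i, is up to sign the cup product of all the coboundaries. *)
Lemma coboundary_cup i d :
  \sum_(l < (i.+1 + d).+1) (-1) ^+ l *
    (\prod_(0 <= j < i) (a j (bump l j.+1) - a j (bump l j)) *
     a i (bump l i) *
     \prod_(i.+1 <= j < i.+1 + d) (a j (bump l j) - a j (bump l j.-1))) =
  (-1) ^+ i * \prod_(0 <= j < i.+1 + d) (a j j.+1 - a j j).
Proof.
pose P l := \prod_(0 <= j < i) (a j (bump l j.+1) - a j (bump l j)).
pose Q l := \prod_(i.+1 <= j < i.+1 + d) (a j (bump l j) - a j (bump l j.-1)).
rewrite -(big_mkord xpredT (fun l => (-1) ^+ l * (P l * a i (bump l i) * Q l))).
rewrite (big_cat_nat_idem _ (n := i.+1)) ?addr0 //=; last by lia.
rewrite [in RHS](big_cat_nat _ (n := i.+1)) ?leq_addr//= [in RHS]big_nat_recr //=.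
set p := \prod_(0 <= j < i) (a j j.+1 - a j j).
set q := \prod_(i.+1 <= j < i.+1 + d) (a j j.+1 - a j j).
have -> : \sum_(0 <= l < i.+1) (-1) ^+ l * (P l * a i (bump l i) * Q l) =
    (-1) ^+ i * p * a i i.+1 * q.
  rewrite -alternating_prefix -(big_mkord xpredT (fun l => (-1) ^+ l * P l)).
  rewrite !mulr_suml; apply: eq_big_nat => l li.
  have -> : bump l i = i.+1 by rewrite /bump; lia.
  have -> : Q l = q.
    apply: eq_big_nat => j ij.
    have -> : bump l j = j.+1 by rewrite /bump; lia.
    by have -> : bump l j.-1 = j by rewrite /bump; lia.
  ring.
have -> : \sum_(i.+1 <= l < (i.+1 + d).+1) (-1) ^+ l * (P l * a i (bump l i) * Q l) =
    p * a i i * ((-1) ^+ i.+1 * q).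
  rewrite -alternating_suffix mulr_sumr; apply: eq_big_nat => l li.
  have -> : bump l i = i by rewrite /bump; lia.
  have -> : P l = p.
    apply: eq_big_nat => j ij.
    have -> : bump l j = j by rewrite /bump; lia.
    by have -> : bump l j.+1 = j.+1 by rewrite /bump; lia.
  rewrite /Q; ring.
by rewrite exprS; ring.
Qed.
End Leibniz.

(** * Degree of sign patterns on a grid *)

Section Degree.
Variables n N : nat.
Local Notation vtx := ('I_n.+1 -> nat).

(** Stokes' formula for a cochain that vanishes on the boundary of the grid: the
    inner faces cancel in pairs inside each cube, and the outer ones between
    neighbouring cubes. *)
Lemma kuhn_sum_coboundary (c : (nat -> vtx) -> int) :
  (forall w w', (forall k, (k <= n)%N -> w k = w' k) -> c w = c w') ->
  (forall w a, (forall k, (k <= n)%N -> w k a = 0%N) -> c w = 0) ->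
  (forall w a, (forall k, (k <= n)%N -> w k a = N) -> c w = 0) ->
  kuhn_sum N (fun v => \sum_(l < n.+2) (-1) ^+ l * c (v \o bump l)) = 0.
Proof.
move=> cext c0 cN.
have -> : kuhn_sum N (fun v => \sum_(l < n.+2) (-1) ^+ l * c (v \o bump l)) =
    \sum_(l < n.+2) (-1) ^+ l * kuhn_sum N (fun v => c (v \o bump l)).
  rewrite /kuhn_sum; under [RHS]eq_bigr do rewrite mulr_sumr.
  rewrite [RHS]exchange_big /=; apply: eq_bigr => p _.
  under [RHS]eq_bigr do rewrite mulr_sumr.
  rewrite [RHS]exchange_big /=; apply: eq_bigr => s _.
  by rewrite mulr_sumr; apply: eq_bigr => l _; rewrite mulrCA.
rewrite big_ord_recl big_ord_recr /= big1 ?add0r => [|l _]; last first.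
  by rewrite kuhn_sum_inner_face ?mulr0// /bump /=; have := ltn_ord l; lia.
by rewrite mul1r kuhn_sum_outer_faces// exprS mulN1r mulNr subrr.
Qed.

(** The value on the simplex [v] of the cup product of the coboundaries of
    [h 0], ..., [h n].  The cochains are indexed by [nat] to make it possible to
    cut this product at any position. *)
Definition cup_product (h : nat -> vtx -> int) (v : nat -> vtx) : int :=
  \prod_(0 <= j < n.+1) (h j (v j.+1) - h j (v j)).

Definition separates_faces (h : nat -> vtx -> int) : Prop :=
  forall (a : 'I_n.+1) (x : vtx), (x a = 0%N -> h a x = 0) /\ (x a = N -> h a x = 1).

(** The difference of the two sides is the signed sum of a cup product whose i-th
    factor is the coboundary of [h i - h' i].  By the Leibniz rule it is the
    coboundary of a cochain [c] that vanishes on the boundary: on the faces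
    orthogonal to the axis i because [h i - h' i] does, on the others because one
    of the remaining factors is the coboundary of a constant. *)
Lemma kuhn_sum_cup_update (h h' : nat -> vtx -> int) (i : 'I_n.+1) :
  separates_faces h -> separates_faces h' ->
  (forall j : nat, j != i -> h j = h' j) ->
  kuhn_sum N (cup_product h) = kuhn_sum N (cup_product h').
Proof.
move=> sh sh' hh'.
pose k (j : nat) x : int := if j == i then h j x - h' j x else h j x.
have kE (j : nat) : j != i -> k j = h j by rewrite /k => /negbTE ->.
have ki x : k i x = h i x - h' i x by rewrite /k eqxx.
have ni : ((0 : nat) <= i < n.+1)%N by rewrite ltn_ord.
apply/eqP; rewrite -subr_eq0; apply/eqP.
have -> : kuhn_sum N (cup_product h) - kuhn_sum N (cup_product h') =
    kuhn_sum N (cup_product k).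
  rewrite /kuhn_sum -sumrB; apply: eq_bigr => p _.
  rewrite -sumrB; apply: eq_bigr => s _; rewrite -mulrBr; congr (_ * _).
  rewrite /cup_product; set v := kuhn_vertex _ s.
  have iin : (i : nat) \in index_iota 0 n.+1 by rewrite mem_index_iota.
  rewrite !(bigD1_seq (i : nat) iin (iota_uniq _ _))/=.
  rewrite !ki; set A := \prod_(_ <- _ | _) _.
  rewrite (eq_bigr (fun j => h j (v j.+1) - h j (v j))); last first.
    by move=> j ji; rewrite hh'.
  rewrite [in RHS](eq_bigr (fun j => h j (v j.+1) - h j (v j))); last first.
    by move=> j ji; rewrite kE.
  by rewrite -/A; ring.
pose c (w : nat -> vtx) :=
  \prod_(0 <= j < i) (k j (w j.+1) - k j (w j)) * k i (w i) *
  \prod_(i.+1 <= j < n.+1) (k j (w j) - k j (w j.-1)).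
pose d := (n - i)%N.
have nE : n.+1 = (i.+1 + d)%N by rewrite /d; have := ltn_ord i; lia.
have -> : cup_product k =
    (fun v => (-1) ^+ i * \sum_(l < n.+2) (-1) ^+ l * c (v \o bump l)).
  apply: funext => v; have := coboundary_cup (fun j t => k j (v t)) i d.
  by rewrite /= -nE /cup_product /c => ->; rewrite mulrA -expr2 sqrr_sign mul1r.
(* Both kinds of faces orthogonal to an axis, at e = 0 and at e = N. *)
have c_face w (a : 'I_n.+1) e :
    (forall k, (k <= n)%N -> w k a = e) ->
    (forall x : vtx, x a = e -> a = i -> k a x = 0) ->
    (forall x y : vtx, x a = e -> y a = e -> a != i -> k a x = k a y) ->
    c w = 0.
  move=> wa k0 kc; rewrite /c; have := ltn_ord a; have := ltn_ord i => ni' na.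
  have [ai|ai|/val_inj ai] := ltngtP a i.
  - rewrite (bigD1_seq (a : nat)) ?iota_uniq ?mem_index_iota//=.
    rewrite (kc _ (w a)) ?subrr ?mul0r ?wa//; try lia.
    by rewrite neq_ltn ai.
  - rewrite [X in _ * X](bigD1_seq (a : nat)) ?iota_uniq ?mem_index_iota ?ai//=.
    rewrite (kc (w a) (w a.-1)) ?subrr ?mul0r ?mulr0 ?wa//; try lia.
    by rewrite neq_ltn ai orbT.
  - rewrite (_ : k i (w i) = 0) ?mulr0 ?mul0r//.
    by rewrite -ai; apply: k0 => //; rewrite wa// -ltnS.
have := kuhn_sum_coboundary (c := c).
rewrite /kuhn_sum => st.
under eq_bigr do under eq_bigr do rewrite mulrCA.
under eq_bigr do rewrite -mulr_sumr.
rewrite -mulr_sumr st ?mulr0//.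
- move=> w w' ww'; rewrite /c ww'; last by rewrite -ltnS.
  congr (_ * _ * _); apply: eq_big_nat => j ji; rewrite !ww'//; lia.
- move=> w a wa; apply: (c_face w a 0%N wa).
  + move=> x xa ai; rewrite ai ki.
    by rewrite -ai (sh a x).1 ?(sh' a x).1 ?subrr.
  + by move=> x y xa ya ai; rewrite kE// (sh a x).1// (sh a y).1.
- move=> w a wa; apply: (c_face w a N wa).
  + move=> x xa ai; rewrite ai ki.
    by rewrite -ai (sh a x).2 ?(sh' a x).2 ?subrr.
  + by move=> x y xa ya ai; rewrite kE// (sh a x).2// (sh a y).2.
Qed.

Lemma kuhn_sum_cup_eq (h h' : nat -> vtx -> int) :
  separates_faces h -> separates_faces h' ->
  kuhn_sum N (cup_product h) = kuhn_sum N (cup_product h').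
Proof.
move=> sh sh'.
(* The cochains are exchanged one at a time. *)
pose g t j := if (j < t)%N then h' j else h j.
have sg t : separates_faces (g t) by move=> a x; rewrite /g; case: ifP.
have gt t : (t <= n.+1)%N ->
    kuhn_sum N (cup_product (g t)) = kuhn_sum N (cup_product h).
  elim: t => [//|t IH tn]; rewrite -IH; last exact: ltnW.
  apply: (kuhn_sum_cup_update (i := Ordinal tn)) => // j /= jt.
  by rewrite /g ltnS leq_eqVlt (negbTE jt).
rewrite -(gt n.+1)//; congr kuhn_sum; apply: funext => v.
by apply: eq_big_nat => j /andP[_ jn]; rewrite /g jn.
Qed.

(** Only one simplex contributes: its j-th move must be the one along the axis j,
    and it must start at the coordinate 0, for every j. *)
Lemma kuhn_sum_cup_threshold : (0 < N)%N ->
  kuhn_sum N (cup_product (fun j x => (0 < x (inord j))%N%:R)) = 1.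
Proof.
case: N => // N' _.
have factor (p : {ffun 'I_n.+1 -> 'I_N'.+1}) (s : 'S_n.+1) (j : 'I_n.+1) :
    (0 < kuhn_vertex (fun a => p a) s j.+1 j)%N%:R -
    (0 < kuhn_vertex (fun a => p a) s j j)%N%:R =
    ((p j == ord0) && ((s^-1)%g j == j))%:R :> int.
  rewrite /kuhn_vertex -val_eqE -[X in _ && X]val_eqE /=.
  by move: (nat_of_ord (p j)) (nat_of_ord ((s^-1)%g j)) (nat_of_ord j) => *; lia.
have cupE (p : {ffun 'I_n.+1 -> 'I_N'.+1}) (s : 'S_n.+1) :
    cup_product (fun j x => (0 < x (inord j))%N%:R) (kuhn_vertex (fun a => p a) s) =
    \prod_(j < n.+1) ((p j == ord0) && ((s^-1)%g j == j))%:R.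
  rewrite /cup_product big_mkord; apply: eq_bigr => j _.
  by rewrite inord_val factor.
rewrite /kuhn_sum (bigD1 [ffun=> ord0])//= [X in _ + X]big1 ?addr0; last first.
  move=> p p0; apply: big1 => s _; rewrite cupE.
  have [j pj] : exists j, p j != ord0.
    apply: contrapT => H; move/eqP: p0; apply; apply/ffunP => j; rewrite ffunE.
    by apply/eqP; apply: contrapT => /negP pj; apply: H; exists j.
  by rewrite (bigD1 j)//= (negbTE pj) mul0r mulr0.
rewrite (bigD1 1%g)//= [X in _ + X]big1 ?addr0; last first.
  move=> s s1; rewrite cupE.
  have [j sj] : exists j, (s^-1)%g j != j.
    apply: contrapT => H; move/eqP: s1; apply; apply: invg_inj; apply/permP => j.
    rewrite invg1 perm1.
    by apply/eqP; apply: contrapT => /negP pj; apply: H; exists j.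
  by rewrite (bigD1 j)//= (negbTE sj) andbF mul0r mulr0.
rewrite cupE odd_perm1 mul1r big1// => j _.
by rewrite ffunE invg1 perm1 !eqxx.
Qed.

(** The cube given by [p] contains a simplex on which the cup product does not
    vanish; the two ends of its i-th edge are the points wanted for [i]. *)
Lemma discrete_poincare_miranda (P : 'I_n.+1 -> vtx -> bool) : (0 < N)%N ->
  (forall a x, x a = 0%N -> ~~ P a x) -> (forall a x, x a = N -> P a x) ->
  exists p : vtx, (forall a, p a < N)%N /\
    forall i, exists x y : vtx,
      [/\ (forall a, p a <= x a <= (p a).+1)%N,
          (forall a, p a <= y a <= (p a).+1)%N, ~~ P i x & P i y].
Proof.
move=> N0 P0 PN.
pose h j x : int := (P (inord j) x)%:R.
have sh : separates_faces h.
  move=> a x; rewrite /h inord_val; split => [/P0/negbTE->|/PN->] //.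
have st : separates_faces (fun j x => (0 < x (inord j))%N%:R).
  by move=> a x; rewrite inord_val; split => ->//; rewrite N0.
have := kuhn_sum_cup_threshold N0; rewrite -(kuhn_sum_cup_eq sh st) => S1.
have [p [s ps]] : exists p : {ffun 'I_n.+1 -> 'I_N}, exists s : 'S_n.+1,
    cup_product h (kuhn_vertex (fun a => p a) s) != 0.
  apply: contrapT => H.
  suff : kuhn_sum N (cup_product h) = 0 by rewrite S1.
  apply: big1 => p _; apply: big1 => s _.
  have [->|ps] := eqVneq (cup_product h (kuhn_vertex (fun a => p a) s)) 0.
    by rewrite mulr0.
  by exfalso; apply: H; exists p, s.
exists (fun a => p a); split=> [a|i]; first exact: ltn_ord.
set v := kuhn_vertex _ s in ps.
have vcube k a : (p a <= v k a <= (p a).+1)%N.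
  by rewrite /v /kuhn_vertex; lia.
have : h i (v i.+1) - h i (v i) != 0.
  move: ps; rewrite /cup_product big_mkord; apply: contraNN => /eqP hi.
  by rewrite (bigD1 i)//= hi mul0r.
rewrite /h inord_val; case E1 : (P i (v i.+1)); case E2 : (P i (v i)) => // _.
- by exists (v i), (v i.+1); split => //; rewrite E2.
- by exists (v i.+1), (v i); split => //; rewrite E1.
Qed.
End Degree.

(** * Approximate zeros of Lipschitz maps *)

Section EuclideanNorm.
Variables (R : realType) (k : nat).
Implicit Types x y : 'rV[R]_k.

Lemma euclidean_norm0 : euclidean_norm (0 : 'rV[R]_k) = 0.
Proof. by rewrite /euclidean_norm big1 ?sqrtr0// => i _; rewrite mxE expr0n. Qed.

Lemma euclidean_normZ (a : R) x : euclidean_norm (a *: x) = `|a| * euclidean_norm x.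
Proof.
rewrite /euclidean_norm -sqrtr_sqr -sqrtrM ?sqr_ge0//; congr Num.sqrt.
by rewrite mulr_sumr; apply: eq_bigr => i _; rewrite mxE exprMn.
Qed.

Lemma euclidean_normN x : euclidean_norm (- x) = euclidean_norm x.
Proof. by rewrite -scaleN1r euclidean_normZ normrN1 mul1r. Qed.

Lemma euclidean_normB x y : euclidean_norm (x - y) <= euclidean_norm x + euclidean_norm y.
Proof. by rewrite (le_trans (euclidean_normD _ _))// euclidean_normN. Qed.

Lemma euclidean_norm_sum (I : finType) (F : I -> 'rV[R]_k) :
  euclidean_norm (\sum_i F i) <= \sum_i euclidean_norm (F i).
Proof.
apply: (big_ind2 (fun x a => euclidean_norm x <= a)) => [|x a y b xa yb|//].
  by rewrite euclidean_norm0.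
by rewrite (le_trans (euclidean_normD _ _))// lerD.
Qed.

Lemma coord_le_euclidean_norm x i : `|x 0 i| <= euclidean_norm x.
Proof.
rewrite -sqrtr_sqr ler_sqrt ?sum_sqr_ge0// (bigD1 i)//= lerDl.
by apply: sumr_ge0 => j _; exact: sqr_ge0.
Qed.

Lemma euclidean_norm_le_coord x (d : R) :
  (forall i, `|x 0 i| <= d) -> euclidean_norm x <= k%:R * d.
Proof.
move=> xd; rewrite [x]row_sum_delta (le_trans (euclidean_norm_sum _))//.
have -> : k%:R * d = \sum_(i < k) d by rewrite sumr_const card_ord mulr_natl.
apply: ler_sum => i _; rewrite euclidean_normZ.
suff -> : euclidean_norm (delta_mx 0 i : 'rV[R]_k) = 1 by rewrite mulr1.
rewrite /euclidean_norm (bigD1 i)//= big1 ?addr0 => [|j ji].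
  by rewrite mxE !eqxx expr1n sqrtr1.
by rewrite mxE (negbTE ji) andbF expr0n.
Qed.

End EuclideanNorm.

(** In a small grid cube, each coordinate of [H] changes sign, and [H] varies
    little, so all the coordinates of [H] are small at once. *)
Lemma approx_poincare_miranda (R : realType) (n : nat) (M L : R)
    (H : 'rV[R]_n.+1 -> 'rV[R]_n.+1) :
  0 < M -> 0 <= L ->
  (forall x y : 'rV[R]_n.+1, euclidean_dist (H x) (H y) <= L * euclidean_dist x y) ->
  (forall (x : 'rV[R]_n.+1) i, x 0 i = - M -> H x 0 i < 0) ->
  (forall (x : 'rV[R]_n.+1) i, x 0 i = M -> 0 <= H x 0 i) ->
  forall e, 0 < e -> exists x, euclidean_norm (H x) <= e.
Proof.
move=> M0 L0 HL Hneg Hpos e e0.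
(* C / N bounds the norm of H at the corner of a cube whose sides are 2M / N. *)
pose C : R := n.+1%:R * (L * (n.+1%:R * (M *+ 2))).
pose N := (Num.truncn (C / e)).+1.
have NC : C <= e * N%:R.
  by rewrite mulrC -ler_pdivrMr// ltW// truncnS_gt.
have N0 : 0 < N%:R :> R by rewrite ltr0n.
pose g (v : 'I_n.+1 -> nat) : 'rV[R]_n.+1 := \row_a (- M + M *+ 2 * ((v a)%:R / N%:R)).
have [||p [_ pP]] := @discrete_poincare_miranda n N (fun a v => 0 <= H (g v) 0 a) isT.
- move=> a v va; rewrite -ltNge; apply: Hneg.
  by rewrite mxE va mul0r mulr0 addr0.
- move=> a v va; apply: Hpos.
  by rewrite mxE va divff ?gt_eqF// mulr1 mulr2n addKr.
exists (g p).
have gcube v : (forall a, p a <= v a <= (p a).+1)%N -> forall i,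
    `|H (g v) 0 i - H (g p) 0 i| <= L * (n.+1%:R * (M *+ 2)) / N%:R.
  move=> vp i; have := coord_le_euclidean_norm (H (g v) - H (g p)) i.
  rewrite !mxE => /le_trans; apply.
  apply: (le_trans (HL _ _)); rewrite -!mulrA ler_wpM2l//.
  apply: euclidean_norm_le_coord => j; rewrite !mxE.
  rewrite opprD addrACA subrr add0r -mulrBr -mulrBl !normrM.
  rewrite (ger0_norm (mulrn_wge0 _ (ltW M0))) ler_wpM2l ?(mulrn_wge0 _ (ltW M0))//.
  rewrite normfV (ger0_norm (ltW N0)) ler_piMl ?invr_ge0 ?(ltW N0)//.
  have /andP[pv vp'] := vp j.
  by rewrite ger0_norm ?subr_ge0 ?ler_nat// lerBlDl natr1 ler_nat vp'.
apply: (@le_trans _ _ (n.+1%:R * (L * (n.+1%:R * (M *+ 2)) / N%:R))); last first.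
  by rewrite mulrA ler_pdivrMr.
apply: euclidean_norm_le_coord => i.
have [u [w [up wp]]] := pP i; rewrite -ltNge => Hu Hw.
have := gcube u up i; have := gcube w wp i.
rewrite !ler_norml; lra.
Qed.

Section BallMaps.
Variables (R : realType) (k : nat).
Local Notation B := (unit_ball R k).

Lemma euclidean_norm_ball (x : B) : euclidean_norm (sval x) <= 1.
Proof. by rewrite -(@expr_le1 _ 2)// ?euclidean_norm_ge0// sqr_euclidean_norm; case: x. Qed.

Lemma ball_of_norm (x : 'rV[R]_k) : euclidean_norm x <= 1 ->
  exists b : B, sval b = x.
Proof.
move=> x1; have xP : \sum_(i < k) x 0 i ^+ 2 <= 1.
  by rewrite -sqr_euclidean_norm expr_le1// euclidean_norm_ge0.
by exists (exist _ x xP).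
Qed.

Lemma mdist_ball (x y : B) : mdist x y = euclidean_norm (sval x - sval y).
Proof. by []. Qed.

(** The nearest point of the ball is x / max(1, |x|), and this formula gives the
    Lipschitz constant 2 at once. *)
Lemma lipschitz_retraction : exists r : 'rV[R]_k -> B,
  (forall x, euclidean_norm x <= 1 -> sval (r x) = x) /\
  forall x y, mdist (r x) (r y) <= 2 * euclidean_dist x y.
Proof.
pose a (x : 'rV[R]_k) := Num.max 1 (euclidean_norm x).
have a1 x : 1 <= a x by rewrite le_max lexx.
have a0 x : 0 < a x by rewrite (lt_le_trans ltr01).
have ax x : euclidean_norm x <= a x by rewrite le_max lexx orbT.
have /choice[r rE] : forall x, exists b : B, sval b = (a x)^-1 *: x.
  move=> x; apply: ball_of_norm.
  rewrite euclidean_normZ ger0_norm ?invr_ge0 ?(ltW (a0 x))//.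
  by rewrite mulrC ler_pdivrMr// mul1r.
exists r; split.
- by move=> x x1; rewrite rE /a max_l// invr1 scale1r.
- move=> x y; rewrite mdist_ball !rE /euclidean_dist.
  have -> : (a x)^-1 *: x - (a y)^-1 *: y =
      (a x)^-1 *: (x - y) + ((a x)^-1 - (a y)^-1) *: y.
    by rewrite scalerBr scalerBl addrA subrK.
  rewrite (le_trans (euclidean_normD _ _))// mulr_natl mulr2n lerD//.
    rewrite euclidean_normZ ger0_norm ?invr_ge0 ?(ltW (a0 x))//.
    by rewrite ler_piMl ?euclidean_norm_ge0// invf_le1.
  rewrite euclidean_normZ.
  have -> : (a x)^-1 - (a y)^-1 = (a y - a x) / (a x * a y).
    by field; rewrite !gt_eqF.
  have axy : `|a y - a x| <= euclidean_norm (x - y).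
    have : `|euclidean_norm y - euclidean_norm x| <= euclidean_norm (x - y).
      have := euclidean_normD (x - y) y; have := euclidean_normB x (x - y).
      by rewrite subrK opprB addrC subrK ler_norml; lra.
    rewrite /a !ler_norml => /andP[h1 h2].
    by case: (leP 1 (euclidean_norm y)) => h3; case: (leP 1 (euclidean_norm x)) => h4;
      apply/andP; split; lra.
  rewrite normrM normfV normrM !(ger0_norm (ltW (a0 _))).
  rewrite -mulrA (le_trans _ axy)// ler_piMr//.
  rewrite mulrC ler_pdivrMr ?mulr_gt0// mul1r (le_trans (ax y))//.
  by rewrite ler_peMl// (ltW (a0 y)).
Qed.
End BallMaps.

(** Let r be a Lipschitz retraction onto the ball.  The map
    H x = x - r x + K (r x) - y points outwards on the faces of a large cube, so
    it has approximate zeros x.  Since x = H x + (r x - K (r x)) + y, the norm of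
    such an x is at most c + |y| up to a small error, so x lies in the ball, where
    H x = K x - y. *)
Lemma near_identity_dense (R : realType) (n : nat)
    (K : unit_ball R n.+1 -> unit_ball R n.+1) (L c : R) :
  0 <= L -> (forall x y, mdist (K x) (K y) <= L * mdist x y) ->
  (forall x, mdist x (K x) <= c) ->
  forall y : 'rV[R]_n.+1, c + euclidean_norm y < 1 ->
  forall d, 0 < d -> exists x, euclidean_norm (sval (K x) - y) <= d.
Proof.
move=> L0 KL Kc y cy d d0.
have [r [rid rL]] := lipschitz_retraction R n.+1.
have c0 : 0 <= c := le_trans (mdist_ge0 _ _) (Kc (r 0)).
have y1 : euclidean_norm y < 1 by lra.
have coord (b : unit_ball R n.+1) i : `|sval b 0 i| <= 1.
  exact: le_trans (coord_le_euclidean_norm _ _) (euclidean_norm_ball _).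
pose H x := x - sval (r x) + (sval (K (r x)) - y).
pose e := Num.min d ((1 - (c + euclidean_norm y)) / 2).
have e0 : 0 < e by rewrite lt_min d0 divr_gt0// subr_gt0.
(* On the faces |x_i| = 4, the other three terms of H are at most 1. *)
have [||||x|x Hx] := @approx_poincare_miranda R n 4 (3 + L * 2) H _ _ _ _ _ e e0.
- by [].
- by rewrite addr_ge0// mulr_ge0.
- move=> x x'; rewrite /euclidean_dist.
  have -> : H x - H x' = (x - x') - (sval (r x) - sval (r x')) +
      (sval (K (r x)) - sval (K (r x'))).
    by apply/rowP => i; rewrite !mxE; ring.
  have := rL x x'; have := KL (r x) (r x'); rewrite mdist_ball => h1 h2.
  have h3 : L * mdist (r x) (r x') <= L * (2 * euclidean_dist x x') by rewrite ler_wpM2l.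
  have := euclidean_normD ((x - x') - (sval (r x) - sval (r x')))
      (sval (K (r x)) - sval (K (r x'))).
  have := euclidean_normB (x - x') (sval (r x) - sval (r x')).
  rewrite -mdist_ball /euclidean_dist in h2 h3 *; lra.
- move=> x i xi; rewrite !mxE xi; have := coord (r x) i; have := coord (K (r x)) i.
  have := le_lt_trans (coord_le_euclidean_norm y i) y1.
  rewrite !ler_norml ltr_norml; lra.
- move=> i xi; rewrite !mxE xi; have := coord (r x) i; have := coord (K (r x)) i.
  have := le_lt_trans (coord_le_euclidean_norm y i) y1.
  rewrite !ler_norml ltr_norml; lra.
exists (r x).
have ed : e <= d by rewrite ge_min lexx.
have ec : e <= (1 - (c + euclidean_norm y)) / 2 by rewrite ge_min lexx orbT.
have x1 : euclidean_norm x <= 1.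
  have xE : x = H x + (sval (r x) - sval (K (r x))) + y.
    by apply/rowP => i; rewrite !mxE; ring.
  have := euclidean_normD (H x + (sval (r x) - sval (K (r x)))) y; rewrite -xE.
  have := euclidean_normD (H x) (sval (r x) - sval (K (r x))).
  have := Kc (r x); rewrite mdist_ball; lra.
by move: Hx; rewrite /H rid// subrr add0r => /le_trans; apply.
Qed.

(** * Lipschitz smoothing of maps between balls *)

Section Cells.
Variables (R : realType) (k : nat).
Local Notation B := (unit_ball R k).

(** The number of cells, of the order of N^k, is what detects the dimension. *)
Lemma ball_cells (N : nat) :
  exists cell : B -> {ffun 'I_k -> 'I_(N.+1.*2).+1},
    forall x y, cell x = cell y -> mdist x y <= k%:R / N.+1%:R.
Proof.
have N0 : 0 < N.+1%:R :> R by rewrite ltr0n.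
pose t (x : B) i := (sval x 0 i + 1) * N.+1%:R.
have t_itv x i : 0 <= t x i <= (N.+1.*2)%:R.
  have := le_trans (coord_le_euclidean_norm (sval x) i) (euclidean_norm_ball _).
  rewrite ler_norml => /andP[x1 x2]; rewrite mulr_ge0 ?(ltW N0)//=; last lra.
  by rewrite -mul2n natrM ler_wpM2r ?(ltW N0)//; lra.
exists (fun x => [ffun i => inord (Num.truncn (t x i))]) => x y /ffunP xy.
apply: euclidean_norm_le_coord => i; have := xy i; rewrite !ffunE.
have lt z : (Num.truncn (t z i) < (N.+1.*2).+1)%N.
  have /andP[_ tz] := t_itv z i.
  by rewrite ltnS truncn_le_nat (le_lt_trans tz)// ltr_nat.
move=> /(congr1 val); rewrite /= !inordK// => txy.
have /andP[tx _] := t_itv x i; have /andP[ty _] := t_itv y i.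
have := truncn_itv tx; have := truncn_itv ty; rewrite txy -natr1 => h1 h2.
rewrite !mxE -[X in _ <= X]mul1r ler_pdivlMr// -{1}(ger0_norm (ltW N0)) -normrM.
have -> : (sval x 0 i - sval y 0 i) * N.+1%:R = t x i - t y i by rewrite /t; ring.
rewrite ler_norml; lra.
Qed.

Lemma ball_finite_net (eps : R) : 0 < eps ->
  exists (I : finType) (v : I -> B), forall x, exists i, mdist x (v i) <= eps.
Proof.
move=> eps0; pose N := Num.truncn (k%:R / eps).
have [cell cellP] := ball_cells N.
have [b0 _] : exists b : B, sval b = 0.
  by apply: ball_of_norm; rewrite euclidean_norm0.
have /choice[v vP] : forall c, exists b, forall x, cell x = c -> cell b = c.
  move=> c; have [[b bc]|nb] := pselect (exists b, cell b = c).
    by exists b.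
  by exists b0 => x xc; exfalso; apply: nb; exists x.
exists {ffun 'I_k -> 'I_(N.+1.*2).+1}, v => x; exists (cell x).
apply: le_trans (cellP _ _ _) _; first by rewrite (vP _ x).
rewrite ler_pdivrMr ?ltr0n// mulrC -ler_pdivrMr//.
by rewrite ltW// truncnS_gt.
Qed.
End Cells.

(** [F x] is the barycentre of the values of [f] at the points v of a finite net,
    with weights max(0, eps - |x - v|).  These are Lipschitz in x, and their sum
    is at least eps / 2 as some point of the net is that close to x.  The last
    property expresses that [F x] is in the convex hull of the values of [f] near
    x, in the only form that is used below. *)
Lemma lipschitz_smoothing (R : realType) (k l : nat)
    (f : unit_ball R k -> unit_ball R l) (eps : R) : 0 < eps ->
  exists F : unit_ball R k -> unit_ball R l,
    (exists2 L, 0 <= L & forall x y, mdist (F x) (F y) <= L * mdist x y) /\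
    forall x a s, (forall v, mdist x v <= eps -> mdist a (f v) <= s) ->
      mdist a (F x) <= s.
Proof.
move=> eps0; have eps2 : 0 < eps / 2 by rewrite divr_gt0.
have [I [v vnet]] := ball_finite_net k eps2.
pose phi i x := Num.max 0 (eps - mdist x (v i)).
have phi0 i x : 0 <= phi i x by rewrite le_max lexx.
pose D x := \sum_i phi i x.
have Deps x : eps / 2 <= D x.
  have [i xi] := vnet x; rewrite /D (bigD1 i)//= ler_wpDr ?sumr_ge0//.
  rewrite /phi le_max; apply/orP; right; lra.
have D0 x : 0 < D x := lt_le_trans eps2 (Deps x).
pose u i := sval (f (v i)).
pose A x := (D x)^-1 *: \sum_i phi i x *: u i.
(* The weighted mean of the vectors from the values of f to a. *)
have bary x (a : 'rV[R]_l) : D x *: (a - A x) = \sum_i phi i x *: (a - u i).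
  rewrite scalerBr scalerA divff ?gt_eqF// scale1r scaler_suml -sumrB.
  by apply: eq_bigr => i _; rewrite scalerBr.
have hull x (a : 'rV[R]_l) s :
    (forall i, mdist x (v i) <= eps -> euclidean_norm (a - u i) <= s) ->
    euclidean_norm (a - A x) <= s.
  move=> as_; rewrite -(ler_pM2l (D0 x)) -[X in X * _](ger0_norm (ltW (D0 x))).
  rewrite -euclidean_normZ bary (le_trans (euclidean_norm_sum _))//.
  rewrite mulr_suml; apply: ler_sum => i _.
  rewrite euclidean_normZ ger0_norm//.
  have [xi|xi] := leP (mdist x (v i)) eps; first by rewrite ler_wpM2l// as_.
  have -> : phi i x = 0 by rewrite /phi max_l// subr_le0 ltW.
  by rewrite !mul0r.
have /choice[F FE] : forall x, exists b : unit_ball R l, sval b = A x.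
  move=> x; apply: ball_of_norm; rewrite -euclidean_normN -sub0r.
  by apply: hull => i _; rewrite sub0r euclidean_normN euclidean_norm_ball.
exists F; split; last first.
  move=> x a s as_; rewrite mdist_ball FE; apply: hull => i xi.
  by rewrite -mdist_ball as_.
exists (#|I|%:R * 2 / (eps / 2)).
  by rewrite divr_ge0 ?mulr_ge0// ltW.
move=> x y; rewrite (metric_sym (F x)) (mdist_ball (F y)) !FE mulrAC ler_pdivlMr//.
rewrite mulrC (@le_trans _ _ (D x * euclidean_norm (A y - A x)))//.
  by rewrite ler_wpM2r// euclidean_norm_ge0.
rewrite -{1}(ger0_norm (ltW (D0 x))) -euclidean_normZ.
(* Compare the two means at a = A y: for the weights of y, it is 0. *)
have -> : D x *: (A y - A x) = \sum_i (phi i x - phi i y) *: (A y - u i).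
  have := bary y (A y); rewrite subrr scaler0 => /esym yy.
  rewrite bary.
  transitivity (\sum_i phi i x *: (A y - u i) - \sum_i phi i y *: (A y - u i)).
    by rewrite yy subr0.
  rewrite -sumrB.
  by apply: eq_bigr => i _; rewrite scalerBl.
rewrite (le_trans (euclidean_norm_sum _))//.
have -> : #|I|%:R * 2 * mdist x y = \sum_(i : I) (mdist x y * 2).
  by rewrite sumr_const -mulr_natl; ring.
apply: ler_sum => i _; rewrite euclidean_normZ ler_pM ?euclidean_norm_ge0//.
  have := metric_triangle x y (v i); have := metric_triangle y x (v i).
  rewrite (metric_sym y x) /phi => h1 h2; rewrite ler_norml.
  have := mdist_ge0 x y.
  case: (leP 0 (eps - mdist x (v i))); case: (leP 0 (eps - mdist y (v i)));
    move=> *; apply/andP; split; lra.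
rewrite (le_trans (euclidean_normB _ _))// -FE.
have := euclidean_norm_ball (F y); have := euclidean_norm_ball (f (v i)).
rewrite -/(u i); lra.
Qed.

(** Choose points z whose images approximate the Q^m points of a grid.  If Q is
    large, the z are so far apart that no two of them share a cell of size
    1 / (A Q); there are at most (3 A Q)^n cells, which is less than Q^m as
    soon as Q > (3 A)^n. *)
Lemma lipschitz_image_not_dense (R : realType) (m n : nat)
    (G : unit_ball R n -> unit_ball R m) (L rho : R) :
  (n < m)%N -> 0 <= L -> (forall x y, mdist (G x) (G y) <= L * mdist x y) ->
  0 < rho ->
  ~ (forall y : 'rV[R]_m, euclidean_norm y <= rho ->
     forall d, 0 < d -> exists z, euclidean_norm (sval (G z) - y) <= d).
Proof.
move=> nm L0 GL rho0 dense.
have m0 : 0 < m%:R :> R by rewrite ltr0n; apply: leq_ltn_trans nm.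
pose tau := rho / m%:R; have tau0 : 0 < tau by rewrite divr_gt0.
(* With this A, two points in a common cell have images closer than tau / (2 Q). *)
pose A := (Num.truncn (2 * L * n%:R / tau)).+1.
have LA : 2 * L * n%:R < A%:R * tau by rewrite -ltr_pdivrMr// truncnS_gt.
pose Q := ((3 * A) ^ n + 1)%N.
have Q0 : 0 < Q%:R :> R by rewrite ltr0n /Q addn1.
have AQ : (0 < A * Q)%N by rewrite muln_gt0 /= /Q addn1.
pose grid (c : {ffun 'I_m -> 'I_Q}) : 'rV[R]_m := \row_i (tau * ((c i)%:R / Q%:R)).
have d0 : 0 < tau / (4 * Q%:R) by rewrite divr_gt0// mulr_gt0.
have /choice[z zP] : forall c, exists z,
    euclidean_norm (sval (G z) - grid c) <= tau / (4 * Q%:R).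
  move=> c; apply: dense => //.
  have -> : rho = m%:R * tau by rewrite /tau mulrC divfK// gt_eqF.
  apply: euclidean_norm_le_coord => i; rewrite mxE normrM (ger0_norm (ltW tau0)).
  rewrite ler_piMr ?(ltW tau0)// ger0_norm ?divr_ge0// ler_pdivrMr// mul1r ler_nat.
  exact: ltnW.
have [cell cellP] := ball_cells R n (A * Q).-1.
have inj : injective (cell \o z).
  move=> c c' /= /cellP; rewrite prednK// => zz; apply/ffunP => i; apply/val_inj => /=.
  apply: contrapT => cc'.
  have far : tau / Q%:R <= `|grid c 0 i - grid c' 0 i|.
    rewrite !mxE -mulrBr -mulrBl normrM (ger0_norm (ltW tau0)) ler_wpM2l ?(ltW tau0)//.
    rewrite normrM normfV (ger0_norm (ltW Q0)) ler_peMl ?invr_ge0 ?(ltW Q0)//.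
    rewrite ler_normr; have [cl|cl|//] := ltngtP (c i) (c' i).
    - by apply/orP; right; rewrite opprB lerBrDl natr1 ler_nat.
    - by apply/orP; left; rewrite lerBrDl natr1 ler_nat.
  have close : mdist (G (z c)) (G (z c')) < tau / Q%:R / 2.
    apply: le_lt_trans (GL _ _) _; apply: le_lt_trans (ler_wpM2l L0 zz) _.
    rewrite natrM mulrA ltr_pdivrMr; last by rewrite mulr_gt0// ltr0n.
    have -> : tau / Q%:R / 2 * (A%:R * Q%:R) = A%:R * tau / 2.
      by field; rewrite gt_eqF.
    by rewrite ltr_pdivlMr//; move: LA; lra.
  have := zP c; have := zP c'.
  have h1 : tau / Q%:R <= euclidean_norm (grid c - grid c').
    apply: (le_trans far).
    have -> : grid c 0 i - grid c' 0 i = (grid c - grid c') 0 i by rewrite !mxE.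
    exact: coord_le_euclidean_norm.
  have gE : grid c - grid c' = (sval (G (z c)) - sval (G (z c'))) -
      (sval (G (z c)) - grid c) + (sval (G (z c')) - grid c').
    by apply/rowP => j; rewrite !mxE; ring.
  have := euclidean_normD ((sval (G (z c)) - sval (G (z c'))) -
      (sval (G (z c)) - grid c)) (sval (G (z c')) - grid c').
  have := euclidean_normB (sval (G (z c)) - sval (G (z c'))) (sval (G (z c)) - grid c).
  rewrite -gE -mdist_ball.
  have -> : tau / (4 * Q%:R) = tau / Q%:R / 4 by field; rewrite gt_eqF.
  lra.
have := leq_card _ inj; rewrite !card_ffun !card_ord prednK//.
apply/negP; rewrite -ltnNge.
have Qm : (Q ^ n.+1 <= Q ^ m)%N by rewrite leq_pexp2l// /Q addn1.
apply: leq_trans Qm.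
have h : ((A * Q).*2.+1 ^ n <= (3 * A * Q) ^ n)%N.
  have : ((A * Q).*2.+1 <= 3 * A * Q)%N by lia.
  by case: (n) => // n' h; rewrite leq_exp2r.
apply: leq_ltn_trans h _; rewrite expnMn expnS ltn_pmul2r ?expn_gt0 ?/Q ?addn1//.
Qed.

(** * The Gromov-Hausdorff distance of two balls *)

Theorem proposition1 (R : realType) (m n : nat) (hn : (1 <= n)%N) (hmn : (n < m)%N) :
  ((1 / 8 : R)%R%:E <= dGH (unit_ball R m) (unit_ball R n))%E.
Proof.
apply/ereal_infP => _ [Z [phi [psi [iphi ipsi ->]]]].
apply/ereal_infP => _ [e [e0 hphi hpsi] <-].
rewrite lee_fin leNgt; apply/negP => e8.
case: m hmn phi iphi hphi hpsi => // m hmn phi iphi hphi hpsi.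
have /choice[f fP] : forall x, exists w, mdist (psi w) (phi x) < e.
  move=> x; have [_ [w _ <-]] := hphi (phi x) (ex_intro2 _ _ x I erefl).
  by rewrite ballEmdist /= => h; exists w.
have /choice[g gP] : forall w, exists x, mdist (phi x) (psi w) < e.
  move=> w; have [_ [x _ <-]] := hpsi (psi w) (ex_intro2 _ _ w I erefl).
  by rewrite ballEmdist /= => h; exists x.
have ff x x' : mdist (f x) (f x') <= mdist x x' + 2 * e.
  rewrite -ipsi -iphi; have := metric_triangle (psi (f x)) (phi x) (psi (f x')).
  have := metric_triangle (phi x) (phi x') (psi (f x')).
  have := fP x; have := fP x'; rewrite (metric_sym (psi (f x')) (phi x')); lra.
have gf x w : mdist x (g w) <= mdist (f x) w + 2 * e.
  rewrite -ipsi -iphi; have := metric_triangle (phi x) (psi (f x)) (phi (g w)).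
  have := metric_triangle (psi (f x)) (psi w) (phi (g w)).
  have := fP x; have := gP w.
  rewrite (metric_sym (phi (g w))) (metric_sym (psi (f x)) (phi x)); lra.
(* Two smoothings at the scale 1/16 cost 1/16 each, and 4e + 1/8 < 5/8. *)
have eps0 : 0 < 1 / 16 :> R by rewrite divr_gt0.
have [F [[LF LF0 FL] Fhull]] := lipschitz_smoothing f eps0.
have [G [[LG LG0 GL] Ghull]] := lipschitz_smoothing g eps0.
have Ff x : mdist (f x) (F x) <= 1 / 16 + 2 * e.
  apply: Fhull => v xv; apply: le_trans (ff _ _) _; lra.
have GF x : mdist x (G (F x)) <= 5 / 8.
  apply: Ghull => w Fw; apply: le_trans (gf _ _) _.
  have := metric_triangle (f x) (F x) w; have := Ff x; lra.
have rho0 : 0 < 1 / 8 :> R by rewrite divr_gt0.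
apply: (lipschitz_image_not_dense hmn LG0 GL rho0) => y y8 d d0.
have KL x x' : mdist (G (F x)) (G (F x')) <= LG * LF * mdist x x'.
  by apply: le_trans (GL _ _) _; rewrite -mulrA ler_wpM2l.
have cy : 5 / 8 + euclidean_norm y < 1 by lra.
have [x xP] := near_identity_dense (mulr_ge0 LG0 LF0) KL GF cy d0.
by exists (F x).
Qed.
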